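(* For $c\in\mathbb{C}$, consider the iteration on $\mathbb{C}^3$ given by $$z_1\to z_1^2+c,\qquad z_2\to (az_1+z_2)^2+c,\qquad z_3\to (z_1+z_2+bz_3)^2+c,$$ with connectivity weights $a=-1$ and $b=-1$. Then the equi-Mandelbrot set of this network, that is, the set of all $c\in\mathbb{C}$ for which the orbit of $(0,0,0)$ under this iteration is bounded in $\mathbb{C}^3$, is a disconnected subset of $\mathbb{C}$.
   Context: All three nodes are updated simultaneously: $(z_1(t+1),z_2(t+1),z_3(t+1))$ is computed from $(z_1(t),z_2(t),z_3(t))$. The equi-Mandelbrot (equi-M) set of a network of quadratic nodes is the locus of $c\in\mathbb{C}$ for which the multi-orbit of the critical point $(0,\dots,0)$ is bounded when all node parameters are equal to $c$. *)

(* Defs.v *)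
From HB Require Import structures.
From mathcomp Require Import all_boot all_order all_algebra.
From mathcomp Require Import complex.
From mathcomp Require Import all_classical all_reals all_analysis.
Set Implicit Arguments.
Unset Strict Implicit.
Unset Printing Implicit Defensive.
Import Order.TTheory GRing.Theory Num.Theory.
Import numFieldNormedType.Exports.
Local Open Scope ring_scope.
Local Open Scope classical_set_scope.

(* [R[i]] packaged as a [numClosedFieldType], because MathComp-Analysis infers
   the topology and the norm on the carrier of such a structure but not on the
   bare type [R[i]]; it is the metric topology of the complex modulus. *)
Definition complexField (R : realType) : numClosedFieldType := R[i].

(* C^3 carries the library's product norm, the maximum of the moduli of the
   three coordinates. *)
Definition net_step (R : realType) (a b c : complexField R)
    (z : complexField R * complexField R * complexField R) :
    complexField R * complexField R * complexField R :=
  let: (z1, z2, z3) := z in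
  (z1 ^+ 2 + c, (a * z1 + z2) ^+ 2 + c, (z1 + z2 + b * z3) ^+ 2 + c).

Definition critical_orbit (R : realType) (a b c : complexField R) (t : nat) :
    complexField R * complexField R * complexField R :=
  iter t (net_step a b c) (0, 0, 0).

Definition equi_mandelbrot (R : realType) (a b : complexField R) :
    set (complexField R) :=
  [set c | bounded_set (range (critical_orbit a b c))].

(* Main.v *)
Require Import Defs.
From Stdlib Require Import ZArith.
From mathcomp Require Import all_boot all_order all_algebra.
From mathcomp Require Import complex.
From mathcomp Require Import ssrZ zify ring lra.
From mathcomp Require Import all_classical all_reals all_analysis.
Set Implicit Arguments.
Unset Strict Implicit.
Unset Printing Implicit Defensive.
Import Order.TTheory GRing.Theory Num.Theory.
Import numFieldNormedType.Exports.
Import ComplexField.Normc.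
Local Open Scope ring_scope.
Local Open Scope classical_set_scope.

(* Both [c = 0] and [c = -1] have a periodic critical orbit, so it suffices that
   no parameter with [Re c = -3/4] belongs to the set. On that line [|Im c| >= 3]
   forces escape at once, and the remaining segment is covered by finitely many
   discs on each of which a few steps of ball arithmetic show that one of three
   coordinates leaves a region where bounded orbits must stay. *)

(** * Elementary estimates for the complex modulus *)

Section Modulus.
Variable R : rcfType.
Local Open Scope complex_scope.
Implicit Types (x y : R) (u v : R[i]).

Lemma normc_ge0 u : 0 <= normc u.
Proof. by case: u => x y; rewrite sqrtr_ge0. Qed.

Lemma normcX2 u : normc (u ^+ 2) = normc u ^+ 2.
Proof. by rewrite !expr2 normcM. Qed.

Lemma le_normcB u v : normc u - normc v <= normc (u - v).
Proof. by rewrite lerBlDr -{1}(subrK v u) le_normcD. Qed.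

Lemma sqr_normcE x y : normc (x +i* y) ^+ 2 = x ^+ 2 + y ^+ 2.
Proof. by rewrite sqr_sqrtr // addr_ge0 // sqr_ge0. Qed.

Lemma normc_le_norm1 x y : normc (x +i* y) <= `|x| + `|y|.
Proof.
rewrite -ler_sqr ?nnegrE ?normc_ge0 ?addr_ge0 //.
rewrite sqr_normcE sqrrD -(real_normK (num_real x)) -(real_normK (num_real y)).
by rewrite -addrA lerD2l lerDr mulrn_wge0 // mulr_ge0.
Qed.

Lemma norm_Re_le u : `|complex.Re u| <= normc u.
Proof.
case: u => x y; rewrite -ler_sqr ?nnegrE ?normc_ge0 // sqr_normcE.
by rewrite real_normK ?num_real // lerDl sqr_ge0.
Qed.

Lemma norm_Im_le u : `|complex.Im u| <= normc u.
Proof.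
case: u => x y; rewrite -ler_sqr ?nnegrE ?normc_ge0 // sqr_normcE.
by rewrite real_normK ?num_real // lerDr sqr_ge0.
Qed.

End Modulus.

(** * Escape radii for the triangular system *)

Section Escape.
Variable R : realType.

(** Once a term reaches [b], the recursion adds at least 1 at every later step, since
    [(b + n) ^ 2 - K >= b + n + 1]; this contradicts the bound [M]. *)
Lemma bounded_quadratic_growth_lt (u : nat -> R) (K b M : R) :
    1 <= b -> K + b + 1 <= b ^+ 2 ->
    (forall t, u t ^+ 2 - K <= u t.+1) -> (forall t, u t <= M) ->
  forall t, u t < b.
Proof.
move=> b1 bK uS uM t; rewrite ltNge; apply/negP => but.
have grow n : b + n%:R <= u (t + n)%N.
  elim: n => [|n IHn]; first by rewrite addr0 addn0.
  rewrite addnS -natr1; apply: le_trans (uS _).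
  have n0 : 0 <= n%:R :> R by [].
  by nra.
have := le_trans (grow (Num.truncn M).+1) (uM _).
have : M < (Num.truncn M).+1%:R by rewrite truncnS_gt.
by lra.
Qed.

(* [z = z1], [w = z2 - z1] and [v = z1 + z2 - z3] turn the network into a
   triangular system. *)
Definition tri_step (c : R[i]) (s : R[i] * R[i] * R[i]) :
    R[i] * R[i] * R[i] :=
  let: (z, w, v) := s in
  (z ^+ 2 + c, w ^+ 2 - z ^+ 2, z ^+ 2 + w ^+ 2 + c - v ^+ 2).

(* For [normc c <= 4], each threshold [b] satisfies [b ^ 2 - K > b], where
   [K] is [4], [3 ^ 2] and [4 + 3 ^ 2 + 4 ^ 2] respectively. *)
Definition escaped (s : R[i] * R[i] * R[i]) : Prop :=
  let: (z, w, v) := s in [\/ 3 <= normc z, 4 <= normc w | 6 <= normc v].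

Definition tri_orbit c t := iter t (tri_step c) (0, 0, 0).

Definition tri_bounded (c : R[i]) (M : R) : Prop :=
  forall t, [/\ normc (tri_orbit c t).1.1 <= M, normc (tri_orbit c t).1.2 <= M
             & normc (tri_orbit c t).2 <= M].

(** The coordinates are treated in triangular order: the bound on [z] enters the constant [K] for
    [w], and both bounds enter the one for [v]. *)
Lemma bounded_not_escaped c M t :
  normc c <= 4 -> tri_bounded c M -> ~ escaped (tri_orbit c t).
Proof.
move=> c4 bM.
pose z t := (tri_orbit c t).1.1; pose w t := (tri_orbit c t).1.2.
pose v t := (tri_orbit c t).2.
have zS t' : z t'.+1 = z t' ^+ 2 + c.
  by rewrite /z /tri_orbit iterS; case: (iter _ _ _) => [[]].
have wS t' : w t'.+1 = w t' ^+ 2 - z t' ^+ 2.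
  by rewrite /w /z /tri_orbit iterS; case: (iter _ _ _) => [[]].
have vS t' : v t'.+1 = z t' ^+ 2 + w t' ^+ 2 + c - v t' ^+ 2.
  by rewrite /v /w /z /tri_orbit iterS; case: (iter _ _ _) => [[]].
have z3 t' : normc (z t') < 3.
  apply: (@bounded_quadratic_growth_lt (fun k => normc (z k)) 4 3 M)
    => /= [|||k];
    [lra | lra | move=> k | by case: (bM k)].
  have := le_normcB (z k ^+ 2) (- c); rewrite opprK -zS normcX2 normcN; lra.
have w4 t' : normc (w t') < 4.
  apply: (@bounded_quadratic_growth_lt (fun k => normc (w k)) 9 4 M)
    => /= [|||k];
    [lra | lra | move=> k | by case: (bM k)].
  have := le_normcB (w k ^+ 2) (z k ^+ 2); rewrite -wS !normcX2.
  by have := z3 k; have := normc_ge0 (z k); nra.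
have v6 t' : normc (v t') < 6.
  apply: (@bounded_quadratic_growth_lt (fun k => normc (v k)) 29 6 M)
    => /= [|||k];
    [lra | lra | move=> k | by case: (bM k)].
  have := le_normcB (v k ^+ 2) (z k ^+ 2 + w k ^+ 2 + c).
  rewrite -(normcN (_ - _)) opprB -vS normcX2.
  have := le_normcD (z k ^+ 2 + w k ^+ 2) c.
  have := le_normcD (z k ^+ 2) (w k ^+ 2); rewrite !normcX2.
  have := z3 k; have := normc_ge0 (z k); have := w4 k; have := normc_ge0 (w k).
  by nra.
have := z3 t; have := w4 t; have := v6 t; rewrite /z /w /v /escaped.
case: (tri_orbit c t) => [[z' w'] v'] /=.
by rewrite !ltNge => /negP ? /negP ? /negP ? [].
Qed.

(** When [normc c >= 3], [normc c] itself can serve as escape threshold, and [z] reaches it at time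
    1, where its value is [c]. *)
Lemma bounded_normc_lt3 c M : tri_bounded c M -> normc c < 3.
Proof.
move=> bM; rewrite ltNge; apply/negP => c3.
pose z t := (tri_orbit c t).1.1.
have zS t' : z t'.+1 = z t' ^+ 2 + c.
  by rewrite /z /tri_orbit iterS; case: (iter _ _ _) => [[]].
suff : normc (z 1%N) < normc c by rewrite zS /z /= expr0n add0r ltxx.
apply: (@bounded_quadratic_growth_lt (fun k => normc (z k))
    (normc c) (normc c) M) => /= [|||k];
    [lra | nra | move=> k | by case: (bM k)].
by have := le_normcB (z k ^+ 2) (- c); rewrite opprK -zS normcX2 normcN; lra.
Qed.

End Escape.

(** * Ball arithmetic with dyadic centres and radii *)

Section Balls.
Variable k : nat.

Local Notation scale := (2%:R ^+ k : Z).

(* [(a, b, r)] stands for the disc of centre [(a + ib) / 2 ^ k] and radius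
   [r / 2 ^ k]; the [+ 3] below absorbs the three rounded divisions. *)
Definition ball_sqr (B : Z * Z * Z) : Z * Z * Z :=
  let: (a, b, r) := B in
  let m := Z.sqrt (a * a + b * b) + 1 in
  (Z.div (a * a - b * b) scale, Z.div (a * b + a * b) scale,
   Z.div (r * (m + m + r)) scale + 3).

Definition ball_add (B1 B2 : Z * Z * Z) : Z * Z * Z :=
  let: (a1, b1, r1) := B1 in let: (a2, b2, r2) := B2 in
  (a1 + a2, b1 + b2, r1 + r2).

Definition ball_sub (B1 B2 : Z * Z * Z) : Z * Z * Z :=
  let: (a1, b1, r1) := B1 in let: (a2, b2, r2) := B2 in
  (a1 - a2, b1 - b2, r1 + r2).

(** [Z.sqrt] rounds down, so the test can only err towards [false]. *)
Definition ball_ge (n : Z) (B : Z * Z * Z) : bool :=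
  let: (a, b, r) := B in n * scale <= Z.sqrt (a * a + b * b) - r.

(* [if _ then true else _] rather than [||], whose right-hand side
   [vm_compute] would evaluate eagerly. *)
Fixpoint ball_escapes (n : nat) (Bc Bz Bw Bv : Z * Z * Z) : bool :=
  if [|| ball_ge 3 Bz, ball_ge 4 Bw | ball_ge 6 Bv] then true else
  if n is n'.+1 then
    let Bz2 := ball_sqr Bz in let Bw2 := ball_sqr Bw in
    ball_escapes n' Bc (ball_add Bz2 Bc) (ball_sub Bw2 Bz2)
      (ball_sub (ball_add (ball_add Bz2 Bw2) Bc) (ball_sqr Bv))
  else false.

(* The segment runs from [(x + ia) / 2 ^ k] to [(x + ib) / 2 ^ k]; [b - m] is
   the larger half length, [m] being rounded down. *)
Fixpoint segment_escapes (depth n : nat) (x a b : Z) : bool :=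
  let m := Z.div (a + b) 2 in
  let O := (0, 0, 0) in
  if ball_escapes n (x, m, b - m) O O O then true else
  if depth is depth'.+1 then
    segment_escapes depth' n x a m && segment_escapes depth' n x m b
  else false.

Variable R : realType.
Local Open Scope complex_scope.

Definition dyadic (a : Z) : R := (int_of_Z a)%:~R / 2 ^+ k.

Definition in_ball (u : R[i]) (B : Z * Z * Z) : Prop :=
  let: (a, b, r) := B in normc (u - (dyadic a +i* dyadic b)) <= dyadic r.

Lemma dyadicD a b : dyadic (a + b) = dyadic a + dyadic b.
Proof. by rewrite /dyadic !rmorphD mulrDl. Qed.

Lemma dyadicB a b : dyadic (a - b) = dyadic a - dyadic b.
Proof. by rewrite /dyadic !rmorphB mulrBl. Qed.

Lemma le_dyadic a b : (dyadic a <= dyadic b) = (a <= b).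
Proof.
rewrite /dyadic ler_pM2r ?invr_gt0 ?exprn_gt0 // ler_int.
by apply/idP/idP; lia.
Qed.

Lemma dyadic_scale a : dyadic (a * scale) = (int_of_Z a)%:~R.
Proof.
by rewrite /dyadic 2!rmorphM 2!rmorphXn 2!rmorph_nat mulfK ?expf_neq0 ?pnatr_eq0.
Qed.

Lemma dyadicM a b : dyadic a * dyadic b = dyadic (a * b) / 2 ^+ k.
Proof. by rewrite /dyadic !rmorphM /= mulrACA mulrA. Qed.

Lemma dyadic_div a :
  dyadic (Z.div a scale) <= dyadic a / 2 ^+ k
    <= dyadic (Z.div a scale) + dyadic 1.
Proof.
have s0 : (0 : Z) < scale by rewrite exprn_gt0.
have /andP[] :
    (Z.div a scale * scale <= a) && (a <= (Z.div a scale + 1) * scale).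
  move: (2 ^+ k) s0 => s s0; have s0' : Z.lt 0 s by lia.
  have := Z.mul_div_le a s s0'; have := Z.mul_succ_div_gt a s s0'.
  by move: (Z.div a s) => q ? ?; apply/andP; split; nia.
rewrite -!le_dyadic !dyadic_scale => h1 h2; rewrite -dyadicD.
have p0 : 0 < (2 ^+ k)^-1 :> R by rewrite invr_gt0 exprn_gt0.
by apply/andP; split; rewrite ler_pM2r.
Qed.

Lemma dyadic_ge0 a : (0 <= dyadic a) = (0 <= a).
Proof. by rewrite -le_dyadic /dyadic rmorph0 mul0r. Qed.

Lemma normc_dyadic_sqrt a b :
  dyadic (Z.sqrt (a * a + b * b)) <= normc (dyadic a +i* dyadic b)
    <= dyadic (Z.sqrt (a * a + b * b) + 1).
Proof.
set n := a * a + b * b.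
have n0 : (0 : Z) <= n by rewrite /n; nia.
have := Z.sqrt_spec n; have := Z.sqrt_nonneg n; move: (Z.sqrt n) => m m0 mn.
have nE : normc (dyadic a +i* dyadic b) ^+ 2 = dyadic n / 2 ^+ k.
  by rewrite sqr_normcE !expr2 !dyadicM -mulrDl -dyadicD.
have p0 : 0 <= (2 ^+ k)^-1 :> R by rewrite invr_ge0 exprn_ge0.
rewrite -[leLHS]ger0_norm ?dyadic_ge0; last by lia.
apply/andP; split; rewrite -ler_sqr ?nnegrE ?normc_ge0 ?normr_ge0 ?dyadic_ge0 //;
  try lia.
  rewrite nE real_normK ?num_real // expr2 dyadicM ler_wpM2r // le_dyadic; lia.
rewrite nE expr2 dyadicM ler_wpM2r // le_dyadic; lia.
Qed.

Lemma in_ball_add u1 u2 B1 B2 :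
  in_ball u1 B1 -> in_ball u2 B2 -> in_ball (u1 + u2) (ball_add B1 B2).
Proof.
case: B1 B2 => [[a1 b1] r1] [[a2 b2] r2] /= h1 h2; rewrite !dyadicD.
apply: le_trans (lerD h1 h2); apply: le_trans (le_normcD _ _).
by rewrite addrACA -opprD.
Qed.

Lemma in_ball_sub u1 u2 B1 B2 :
  in_ball u1 B1 -> in_ball u2 B2 -> in_ball (u1 - u2) (ball_sub B1 B2).
Proof.
case: B1 B2 => [[a1 b1] r1] [[a2 b2] r2] /= h1 h2; rewrite !dyadicB dyadicD.
apply: le_trans (lerD h1 h2); rewrite -(normcN (u2 - _)).
apply: le_trans (le_normcD _ _).
by rewrite -[_ +i* (dyadic b1 - _)]/((_ +i* _) - (_ +i* _)) !opprD addrACA.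
Qed.

Lemma in_ball_sqr u B : in_ball u B -> in_ball (u ^+ 2) (ball_sqr B).
Proof.
case: B => [[a b] r] /=; set c := dyadic a +i* dyadic b; set m := _ + 1 => ur.
have : normc c <= dyadic m by have /andP[] := normc_dyadic_sqrt a b.
move: m => m cm.
have r0 : 0 <= dyadic r := le_trans (normc_ge0 _) ur.
have d1 : normc (u ^+ 2 - c ^+ 2) <= dyadic (r * (m + m + r)) / 2 ^+ k.
  (* The two factors are at most [r] and [r + 2 m], in units of [2 ^ -k]. *)
  have -> : u ^+ 2 - c ^+ 2 = (u - c) * (u - c + c + c) by ring.
  rewrite normcM -dyadicM !dyadicD.
  apply: ler_pM => //; try exact: normc_ge0.
  have := le_normcD (u - c + c) c; have := le_normcD (u - c) c; lra.
(* Rounding the centre costs at most one unit in each of its two coordinates. *)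
have d2 : normc (c ^+ 2 - (dyadic (Z.div (a * a - b * b) scale) +i*
    dyadic (Z.div (a * b + a * b) scale))) <= dyadic 1 + dyadic 1.
  rewrite expr2 /c /=.
  have /andP[] := dyadic_div (a * a - b * b).
  have /andP[] := dyadic_div (a * b + a * b).
  rewrite dyadicB dyadicD mulrBl mulrDl -!dyadicM [dyadic b * dyadic a]mulrC.
  move=> *; apply: le_trans (normc_le_norm1 _ _) _.
  by apply: lerD; rewrite ler_norml; apply/andP; split; lra.
have /andP[_ d3] := dyadic_div (r * (m + m + r)).
rewrite -[3]/(1 + 1 + 1 : Z) !dyadicD.
rewrite -(subrKA (c ^+ 2)); apply: le_trans (le_normcD _ _) _; lra.
Qed.

Lemma in_ball_ge n u B :
  in_ball u B -> ball_ge n B -> (int_of_Z n)%:~R <= normc u.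
Proof.
case: B => [[a b] r] /= ur; rewrite -le_dyadic dyadic_scale dyadicB => nm.
have /andP[sc _] := normc_dyadic_sqrt a b.
have := le_normcB (dyadic a +i* dyadic b) u.
by rewrite -(normcN (_ - _)) opprB; lra.
Qed.

(** Every ball operation encloses the exact one, so an escape certified for the balls holds at all
    their points. The starting state is generalised in the induction because the recursion advances
    it. *)
Lemma ball_escapesP n c Bc z w v Bz Bw Bv :
    in_ball c Bc -> in_ball z Bz -> in_ball w Bw -> in_ball v Bv ->
    ball_escapes n Bc Bz Bw Bv ->
  exists t, escaped (iter t (tri_step c) (z, w, v)).
Proof.
move=> cB; elim: n z w v Bz Bw Bv => [|n IHn] z w v Bz Bw Bv zB wB vB
  /orP[/or3P[/(in_ball_ge zB) ?|/(in_ball_ge wB) ?|/(in_ball_ge vB) ?]|//];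
  try by exists 0%N; by [apply: Or31|apply: Or32|apply: Or33].
have z2 := in_ball_sqr zB; have w2 := in_ball_sqr wB; have v2 := in_ball_sqr vB.
move=> /= /(IHn _ _ _ _ _ _ (in_ball_add z2 cB) (in_ball_sub w2 z2)
  (in_ball_sub (in_ball_add (in_ball_add z2 w2) cB) v2)) [t et].
by exists t.+1; rewrite iterSr.
Qed.

Lemma in_ball0 : in_ball 0 (0, 0, 0).
Proof. by rewrite /in_ball /dyadic rmorph0 mul0r subr0 normc0. Qed.

Lemma segment_escapesP depth n x a b (y : R) :
    segment_escapes depth n x a b -> dyadic a <= y <= dyadic b ->
  exists t, escaped (tri_orbit (dyadic x +i* y) t).
Proof.
elim: depth a b => [|depth IH] a b /orP[esc|rest] /andP[ay yb] //; last first.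
  move: rest; set m := Z.div _ _ => /andP[am mb].
  have [ym|my] := leP y (dyadic m); first by apply: IH am _; rewrite ay.
  by apply: IH mb _; rewrite (ltW my).
all: apply: ball_escapesP in_ball0 in_ball0 in_ball0 esc.
all: rewrite /in_ball; set m := Z.div _ _; apply: le_trans (normc_le_norm1 _ _) _.
all: rewrite subrr normr0 add0r ler_norml dyadicB.
(* As [m] is rounded down, the radius [b - m] also covers the half from [a] to [m]. *)
all: suff : dyadic m + dyadic m <= dyadic a + dyadic b by lra.
all: rewrite -!dyadicD le_dyadic /m.
all: have := Z.mul_div_le (a + b) 2; lia.
Qed.

End Balls.

(** With [k = 16] this is the segment [Re c = -3/4], [|Im c| <= 3], with at most 12 bisections and 8
    iterations. At [c = -3/4] the [z] orbit stays bounded, so the other coordinates are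
    essential. *)
Lemma separating_segment_escapes :
  segment_escapes 16 12 8 (- 3 * 2 ^+ 14) (- 3 * 2 ^+ 16) (3 * 2 ^+ 16).
Proof. by vm_compute. Qed.

(** * Transfer to the network, and separation of its equi-Mandelbrot set *)

Section Network.
Variable R : realType.
Local Open Scope complex_scope.

(** For weights -1, [w] and [v] are, up to sign, the bases of the squares in the second and third
    updates, which makes the new system triangular. *)
Lemma tri_orbitE (c : R[i]) t :
  tri_orbit c t =
    let: (z1, z2, z3) := @critical_orbit R (-1) (-1) c t in
    (z1, z2 - z1, z1 + z2 - z3).
Proof.
elim: t => [|t IHt]; first by rewrite /tri_orbit /critical_orbit /= !subr0 addr0.
rewrite /tri_orbit iterS -/(tri_orbit c t) IHt /critical_orbit iterS.
case: (iter t _ _) => [[z1 z2] z3] /=; rewrite !mulN1r.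
congr (_, _, _); ring.
Qed.

Lemma equi_mandelbrot_tri_bounded (c : R[i]) :
  @equi_mandelbrot R (-1) (-1) c -> exists M, tri_bounded c M.
Proof.
move=> [M [Mreal bM]].
have M1 : M < M + 1 by rewrite ltrDl ltr01.
have {}bM := bM _ M1.
(* The factor 3 accounts for [v], a signed sum of three network coordinates. *)
exists (3 * complex.Re (M + 1)) => t.
rewrite tri_orbitE.
have := bM (@critical_orbit R (-1) (-1) c t) (ex_intro2 _ _ t I erefl).
case: (critical_orbit _ _ _ _) => [[z1 z2] z3] /=.
rewrite !prod_normE /=.
(* The order on the complex field is partial, so the maximum is split using that moduli are real. *)
rewrite !comparable_ge_max ?real_comparable ?normr_real //.
move=> /andP[/andP[h1 h2] h3].
have toR (u : complexField R) : `|u| <= M + 1 -> normc u <= complex.Re (M + 1).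
  by rewrite lecE => /andP[_].
move: h1 h2 h3 => /toR h1 /toR h2 /toR h3; rewrite {toR bM}.
have := normc_ge0 z1; have := le_normcD z2 (- z1); have := le_normcD z1 z2.
have := le_normcD (z1 + z2) (- z3); rewrite !normcN => *; split; lra.
Qed.

Lemma Re_continuous : continuous (fun u : complexField R => complex.Re u : R).
Proof.
move=> c; have FF := nbhs_filter c.
apply/cvgrPdist_lt => e e0.
apply/nbhs_ballP; exists (e%:C : complexField R) => /=; first by rewrite ltcR.
move=> d; rewrite /ball /= => cd.
rewrite -raddfB.
apply: le_lt_trans (norm_Re_le _) _.
by rewrite -ltcR.
Qed.

(** The orbit repeats its first [n.+1] states, and the sum of their norms bounds each of them. *)
Lemma equi_mandelbrot_periodic (a b c : complexField R) n :
  critical_orbit a b c n.+1 = (0, 0, 0) -> equi_mandelbrot a b c.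
Proof.
move=> per; have orbit_mod t :
    critical_orbit a b c t = critical_orbit a b c (t %% n.+1).
  rewrite {1}(divn_eq t n.+1) /critical_orbit addnC iterD; congr iter.
  elim: (t %/ n.+1)%N => // q IHq.
  by rewrite mulSn addnC iterD -/(critical_orbit _ _ _ n.+1) per IHq.
pose S := \sum_(i < n.+1) `|critical_orbit a b c i|.
have S0 : 0 <= S by rewrite sumr_ge0.
exists S; split; first exact: ger0_real.
move=> M SM _ [t _ <-]; apply: le_trans (ltW SM).
rewrite orbit_mod /S (bigD1 (Ordinal (ltn_pmod t (ltn0Sn n)))) //=.
by rewrite lerDl sumr_ge0.
Qed.

Lemma equi_mandelbrot0 : @equi_mandelbrot R (-1) (-1) 0.
Proof.
apply: (@equi_mandelbrot_periodic _ _ _ 0).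
by rewrite /critical_orbit /=; congr (_, _, _); ring.
Qed.

Lemma equi_mandelbrotN1 : @equi_mandelbrot R (-1) (-1) (-1).
Proof.
(* The first coordinate has period 2 here, but the whole state returns to 0 only after 4 steps. *)
apply: (@equi_mandelbrot_periodic _ _ _ 3).
by rewrite /critical_orbit /=; congr (_, _, _); ring.
Qed.

Lemma equi_mandelbrot_Re (c : complexField R) :
  equi_mandelbrot (-1) (-1) c -> complex.Re c != - (3 / 4).
Proof.
move=> /equi_mandelbrot_tri_bounded [M bM]; apply/eqP => cRe.
have c3 := bounded_normc_lt3 bM.
have /ltr_normlP[yl yu] := le_lt_trans (norm_Im_le _) c3.
have [|t et] := @segment_escapesP 16 R _ _ _ _ _ (complex.Im c)
    separating_segment_escapes.
  by rewrite !dyadic_scale; apply/andP; split; lra.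
have xE : dyadic 16 R (- 3 * 2 ^+ 14) = complex.Re c.
  set x : Z := - 3 * 2 ^+ 14.
  (* Four copies of [x] make [- 3 * 2 ^+ 16], an exact multiple of the scale. *)
  have : dyadic 16 R (x + x + (x + x)) = (int_of_Z (- 3))%:~R.
    by rewrite -(dyadic_scale 16).
  by rewrite 2!dyadicD cRe; lra.
apply: (bounded_not_escaped (t := t) _ bM); first by lra.
by case: (c) xE et => x y /= ->.
Qed.

End Network.

Theorem proposition2p3 (R : realType) :
  ~ connected (equi_mandelbrot (-1 : complexField R) (-1 : complexField R)).
Proof.
move=> Mconn; pose Re (u : complexField R) : R := complex.Re u.
have ReC : {within equi_mandelbrot (-1) (-1), continuous Re}.
  exact/continuous_subspaceT/Re_continuous.
(* The real parts would form an interval containing -1 and 0, hence also -3/4. *)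
have /connected_intervalP itv := connected_continuous_connected Mconn ReC.
have [|||c Mc /eqP] := itv (-1) 0 _ _ (- (3 / 4)).
- by exists (-1); [exact: equi_mandelbrotN1|].
- by exists 0; [exact: equi_mandelbrot0|].
- by apply/andP; split; lra.
by apply/negP; exact: equi_mandelbrot_Re.
Qed.
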